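(* On the class of cycles, the AMP (Avoid Midpoint) algorithm with two agents has competitive ratio $1$ in the energy model and competitive ratio $1.5$ in the time model.
   Context: Multi-agent online graph exploration: an undirected connected graph $G=(V,E)$ with positive edge lengths $l(e)$ and distinctly labelled nodes is initially unknown. Agents start at a node $s$; initially they know $s$, its incident edges (with lengths) and its neighbours. Whenever an agent visits a node $v$ for the first time, all edges incident to $v$ (with lengths) and the neighbours of $v$ are revealed. Agents share all information instantly, have unlimited computation, move at unit speed (traversing $e$ takes time $l(e)$), and may wait. The exploration is finished when every node has been visited and all agents are back at $s$. Time model: cost is the finishing time. Energy model: cost is the maximum total distance travelled by any single agent. $opt(G,s,k)$ is the minimum cost of an exploration by $k$ agents with full prior knowledge of $G$; an online algorithm has competitive ratio $c$ on a class if $c$ is the supremum of its cost divided by $opt(G,s,k)$ over all $G$ in the class and $s\in V$. A cycle is a connected graph in which every node has degree 2. AMP algorithm: two agents $a_1,a_2$ start at $s$ with travelled distances $d(a_1)=d(a_2)=0$; the two neighbours of $s$ are assigned (randomly) as the next nodes $n(a_1),n(a_2)$, so the agents go around the cycle in opposite directions; let $l_i$ be the length of the edge from the current position of $a_i$ to $n(a_i)$. While not all nodes have been visited: if $d(a_1)+l_1<d(a_2)+l_2$ then $a_1$ traverses its edge to $n(a_1)$, otherwise $a_2$ traverses its edge to $n(a_2)$; the moving agent adds the edge length to its travelled distance and its next node becomes the newly revealed neighbour (only one agent moves at a time). Afterwards both agents return to $s$ along shortest paths. *)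

(* Defs.v *)
From HB Require Import structures.
From mathcomp Require Import all_boot all_order all_algebra.
From mathcomp Require Import all_classical all_reals all_analysis.
Set Implicit Arguments.
Unset Strict Implicit.
Unset Printing Implicit Defensive.
Import Order.TTheory GRing.Theory Num.Theory.
Local Open Scope ring_scope.

(* Finite connected simple graphs with positive edge lengths. Only the values
   [len u v] at adjacent [u], [v] are meaningful. *)
Record wgraph (R : realType) := WGraph {
  vertex :> finType;
  adj : rel vertex;
  len : vertex -> vertex -> R;
  adj_sym : symmetric adj;
  adj_irr : irreflexive adj;
  adj_conn : forall u v : vertex, connect adj u v;
  len_sym : forall u v : vertex, len u v = len v u;
  len_gt0 : forall u v : vertex, adj u v -> 0 < len u v
}.

Definition is_cycle (R : realType) (G : wgraph R) : Prop :=
  forall u : G, #|[set v : G | adj u v]| = 2%N.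

(* A walk from [u] is given by the list [p] of the nodes entered after [u]. *)
Fixpoint walk_len (R : realType) (G : wgraph R) (u : G) (p : seq G) : R :=
  if p is v :: p' then len u v + walk_len v p' else 0.

Definition shortest_walk (R : realType) (G : wgraph R) (u v : G) (p : seq G) :
    Prop :=
  [/\ path (@adj R G) u p, last u p = v &
      forall q, path (@adj R G) u q -> last u q = v ->
        walk_len u p <= walk_len u q].

(* An agent waits at its current node, or traverses an edge to a neighbour at
   unit speed. *)
Inductive action (R : realType) (G : wgraph R) :=
  | Wait of R
  | Move of G.

Arguments Wait {R G} _.
Arguments Move {R G} _.

Definition route (R : realType) (G : wgraph R) (x : seq (action G)) : seq G :=
  pmap (fun a => if a is Move v then Some v else None) x.

Definition wait_time (R : realType) (G : wgraph R) (a : action G) : R :=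
  if a is Wait t then t else 0.

Definition travelled (R : realType) (G : wgraph R) (s : G)
    (x : seq (action G)) : R :=
  walk_len s (route x).

Definition duration (R : realType) (G : wgraph R) (s : G)
    (x : seq (action G)) : R :=
  travelled s x + \sum_(a <- x) wait_time a.

(* All agents start at [s] at time 0 and execute their own list of actions. *)
Definition strategy (R : realType) (G : wgraph R) (k : nat) :=
  'I_k -> seq (action G).

Definition is_exploration (R : realType) (G : wgraph R) (s : G) (k : nat)
    (X : strategy G k) : Prop :=
  [/\ forall i, all (fun a => 0 <= wait_time a) (X i),
      forall i, path (@adj R G) s (route (X i)),
      forall i, last s (route (X i)) = s &
      forall v : G, exists i, v \in s :: route (X i)].

Definition cost_model (R : realType) :=
  forall (G : wgraph R) (s : G) (k : nat), strategy G k -> R.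

(* The last completion time of the agents' action lists. It is the time at
   which the exploration is finished unless some list ends with idle waiting at
   [s] that outlasts the exploration, which does not affect the optimum. *)
Definition time_cost (R : realType) : cost_model R :=
  fun G s k X => \big[Num.max/0]_(i < k) duration s (X i).

Definition energy_cost (R : realType) : cost_model R :=
  fun G s k X => \big[Num.max/0]_(i < k) travelled s (X i).

(* The costs of explorations are bounded below by 0 and range over sums of edge
   lengths and waiting times, and waiting never lowers a cost; so for [0 < k]
   the infimum is a minimum. *)
Definition opt (R : realType) (cost : cost_model R) (G : wgraph R) (s : G)
    (k : nat) : R :=
  inf [set cost G s k X | X in [set X | is_exploration s X]]%classic.

(* An algorithm is represented by the strategy that results from running it on
   [G] from [s]. *)
Definition algorithm (R : realType) (k : nat) :=
  forall (G : wgraph R) (s : G), strategy G k.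

Definition has_competitive_ratio (R : realType) (cost : cost_model R)
    (C : wgraph R -> Prop) (k : nat) (alg : algorithm R k) (c : R) : Prop :=
  (forall (G : wgraph R) (s : G), C G -> is_exploration s (alg G s)) /\
  ereal_sup [set r : \bar R | exists (G : wgraph R) (s : G),
      C G /\ r = (cost G s k (alg G s) / opt cost s k)%:E]%classic = c%:E.

(* In a cycle, the neighbour of [v] other than its neighbour [u]. *)
Definition other_nbr (R : realType) (G : wgraph R) (u v : G) : G :=
  odflt v [pick w | adj v w && (w != u)].

Definition a1 : 'I_2 := ord0.
Definition a2 : 'I_2 := ord_max.

Record amp_state (R : realType) (G : wgraph R) := AmpState {
  pos : 'I_2 -> G;
  nxt : 'I_2 -> G;
  dist : 'I_2 -> R;
  visited : {set G};
  done_actions : 'I_2 -> seq (action G)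
}.

Definition amp_init (R : realType) (G : wgraph R) (s n1 : G) : amp_state G :=
  {| pos := fun=> s;
     nxt := fun i => if i == a1 then n1 else other_nbr n1 s;
     dist := fun=> 0;
     visited := [set s];
     done_actions := fun=> [::] |}.

Definition amp_mover (R : realType) (G : wgraph R) (st : amp_state G) : 'I_2 :=
  if dist st a1 + len (pos st a1) (nxt st a1)
     < dist st a2 + len (pos st a2) (nxt st a2)
  then a1 else a2.

(* The other agent waits while the chosen one traverses its edge. *)
Definition amp_move (R : realType) (G : wgraph R) (st : amp_state G) :
    amp_state G :=
  let m := amp_mover st in
  let u := pos st m in
  let v := nxt st m in
  {| pos := fun i => if i == m then v else pos st i;
     nxt := fun i => if i == m then other_nbr u v else nxt st i;
     dist := fun i => if i == m then dist st i + len u v else dist st i;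
     visited := v |: visited st;
     done_actions := fun i =>
       rcons (done_actions st i) (if i == m then Move v else Wait (len u v)) |}.

(* The body of the while loop, idle once all nodes have been visited. Every
   effective pass visits a new node, so [#|G|] passes complete the loop. *)
Definition amp_pass (R : realType) (G : wgraph R) (st : amp_state G) :
    amp_state G :=
  if visited st == [set: G]%SET then st else amp_move st.

Definition amp_loop (R : realType) (G : wgraph R) (s n1 : G) : amp_state G :=
  iter #|G| (@amp_pass R G) (amp_init s n1).

(* [first G s] is the neighbour of [s] assigned to [a1], i.e. the outcome of the
   random assignment. The return walks are traversed simultaneously once the
   loop has ended; [xget] picks one of the shortest walks. *)
Definition amp (R : realType) (first : forall G : wgraph R, G -> G) :
    algorithm R 2 :=
  fun G s i =>
    let st := amp_loop s (first G s) in
    done_actions st i ++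
      map Move (xget [::] [set p | shortest_walk (pos st i) s p]%classic).

(* Main.v *)
(** The loop of AMP is Dijkstra's algorithm: in a cycle the only edges leaving the
    visited set are the next edges of the two agents, and the agent with the
    smaller resulting distance moves, so each travelled distance [d i] is the
    graph distance from [s] to the current position. Hence the return walk of
    agent [i] again has length [d i]; the energy cost is [2 * max (d a1) (d a2)]
    and the time cost is [d a1 + d a2 + max (d a1) (d a2)]. In every exploration
    some agent reaches the final position of agent [i] and comes back, so both
    optima are at least [2 * max (d a1) (d a2)]. The ratio 3/2 is attained on the
    triangle with unit lengths. *)
Require Import Defs.
From HB Require Import structures.
From mathcomp Require Import all_boot all_order all_algebra.
From mathcomp Require Import all_classical all_reals all_analysis.
From mathcomp Require Import lra.
Set Implicit Arguments.
Unset Strict Implicit.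
Unset Printing Implicit Defensive.
Import Order.TTheory GRing.Theory Num.Theory.
Local Open Scope ring_scope.

Lemma ord2_case (i : 'I_2) : i = a1 \/ i = a2.
Proof. by case: i => [[|[|//]] Hi]; [left | right]; apply: val_inj. Qed.

Lemma bigmax_ord2 (R : realType) (f : 'I_2 -> R) :
  (forall i, 0 <= f i) -> \big[Num.max/0]_(i < 2) f i = Num.max (f a1) (f a2).
Proof.
move=> f0; rewrite !big_ord_recl big_ord0 (max_idPl (f0 _)).
by congr (Num.max (f _) (f _)); apply: val_inj.
Qed.

(** * Walks, and the parity of cuts in a cycle *)

Section Walks.
Variables (R : realType) (G : wgraph R).
Implicit Types (u v w : G) (p q : seq G) (S : {set G}).

Lemma walk_len_cat u p q :
  walk_len u (p ++ q) = walk_len u p + walk_len (last u p) q.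
Proof. by elim: p u => [|v p IH] u /=; rewrite ?add0r // IH addrA. Qed.

Lemma walk_len_ge0 u p : path (@adj R G) u p -> 0 <= walk_len u p.
Proof.
elim: p u => [|v p IH] u //= /andP[uv pv].
by rewrite addr_ge0 ?IH // ltW // len_gt0.
Qed.

Lemma walk_len_gt0 u v p : path (@adj R G) u p -> v \in p -> 0 < walk_len u p.
Proof.
case: p => [|w p] //= /andP[uw pw] _.
by rewrite ltr_wpDr ?walk_len_ge0 ?len_gt0.
Qed.

Lemma walk_len_unit u p : (forall v w, len v w = 1) ->
  walk_len u p = (size p)%:R.
Proof.
by move=> len1; elim: p u => [|v p IH] u //=; rewrite IH len1 -natr1 addrC.
Qed.

(** Turns walks back to [s] into walks from [s], the only ones that the invariant of the loop bounds
    from below. *)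
Lemma walk_rev u p : path (@adj R G) u p ->
  exists q, [/\ path (@adj R G) (last u p) q, last (last u p) q = u &
    walk_len (last u p) q = walk_len u p].
Proof.
elim: p u => [|v p IH] u /=; first by exists [::].
move=> /andP[uv /IH[q [pq lq wq]]]; exists (q ++ [:: u]).
rewrite cat_path pq last_cat lq walk_len_cat lq wq /= adj_sym uv.
by split=> //; rewrite addr0 addrC len_sym.
Qed.

Lemma walk_exit S u p : path (@adj R G) u p -> u \in S -> last u p \notin S ->
  exists p1 w p2, [/\ p = p1 ++ w :: p2, last u p1 \in S, w \notin S &
    adj (last u p1) w].
Proof.
elim: p u => [|v p IH] u /=; first by move=> _ ->.
case/andP=> uv pv uS lS; case: (boolP (v \in S)) => vS; last first.
  by exists [::], v, p.
by have [p1 [w [p2 [-> ? ? ?]]]] := IH _ pv vS lS; exists (v :: p1), w, p2.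
Qed.

Lemma cut_edge S u v : u \in S -> v \notin S ->
  exists x y, [/\ x \in S, y \notin S & adj x y].
Proof.
move=> uS; have /connectP[p pp ->] := adj_conn u v => vS.
by have [p1 [w [p2 [_ ? ? ?]]]] := walk_exit pp uS vS; exists (last u p1), w.
Qed.

(** Removing [v] from [S] removes each edge between [v] and the rest twice, once per direction, and
    [v] has no loop; so the parity is unchanged. *)
Lemma handshake S : odd (\sum_(u in S) \sum_(w in S) adj u w)%N = false.
Proof.
have [n] := ubnP #|S|; elim: n S => // n IH S.
have [->|[v vS]] := set_0Vmem S; first by rewrite big_set0.
rewrite (cardsD1 v) vS add1n ltnS => /IH odd0; rewrite -(finset.setD1K vS).
have vS' : v \notin S :\ v by rewrite finset.setD11.
rewrite big_setU1 //= big_setU1 //= adj_irr add0n.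
under [X in (_ + X)%N]eq_bigr => u _ do rewrite big_setU1 //= adj_sym.
by rewrite big_split /= !oddD odd0 addbF addbb.
Qed.

Section Cycle.
Hypothesis cycG : is_cycle G.

(** The degrees in [S] add up to [2 * #|S|], and the part of this sum that stays inside [S] is even
    by [handshake]. *)
Lemma cut_even S : odd (\sum_(u in S) \sum_(w in ~: S) adj u w)%N = false.
Proof.
have deg u : (\sum_(w in S) adj u w + \sum_(w in ~: S) adj u w = 2)%N.
  rewrite -(cycG u) -sum1_card [RHS]big_mkcond [RHS](bigID (mem S)) /=.
  by congr (_ + _)%N; apply: eq_big => w; rewrite ?inE //= => _; case: adj.
have : odd (\sum_(u in S) (\sum_(w in S) adj u w + \sum_(w in ~: S) adj u w))%N
    = false.
  by under eq_bigr do rewrite deg; rewrite sum_nat_const oddM andbF.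
by rewrite big_split oddD handshake.
Qed.

(** If [(x, y)] were the only edge leaving [S], the even sum of [cut_even] would equal 1. *)
Lemma cycle_bridgeless S x y : x \in S -> y \notin S -> adj x y ->
  exists u w, [/\ u \in S, w \notin S, adj u w & (u, w) <> (x, y)].
Proof.
move=> xS yS xy; apply: contrapT => no; have := cut_even S.
have uniq_cut u w : u \in S -> w \notin S -> adj u w -> (u, w) = (x, y).
  by move=> uS wS uw; apply: contrapT => ne; apply: no; exists u, w.
rewrite (bigD1 x) //= (bigD1 y) ?inE //= xy big1 ?big1 //.
- move=> u /andP[uS ux]; apply: big1 => w; rewrite inE => wS.
  case uw: adj => //; have [ex _] := uniq_cut _ _ uS wS uw.
  by rewrite ex eqxx in ux.
- move=> w /andP[]; rewrite inE => wS wy.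
  case xw: adj => //; have [ey] := uniq_cut _ _ xS wS xw.
  by rewrite ey eqxx in wy.
Qed.

Lemma other_nbrP u v : adj v u ->
  adj v (other_nbr u v) /\ forall w, adj v w -> w = u \/ w = other_nbr u v.
Proof.
move=> vu; have /eqP/cards2P[x [y [xy Nv]]] := cycG v.
have Ne z : adj v z = (z == x) || (z == y).
  by have := congr1 (fun A : {set G} => z \in A) Nv; rewrite !inE.
(* The default of [odflt] is never returned: one of the two distinct neighbours differs from [u]. *)
rewrite /other_nbr; case: pickP => [z /andP[vz zu]|none] /=; last first.
  have := vu; rewrite Ne => /orP[/eqP eu|/eqP eu].
    by have := none y; rewrite Ne eqxx orbT eu eq_sym xy.
  by have := none x; rewrite Ne eqxx eu xy.
split=> // w vw; move: vu vw vz zu; rewrite !Ne.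
by do 3![case/orP=> /eqP->]; rewrite ?eqxx //; auto.
Qed.

End Cycle.
End Walks.

(** * Routes and durations of action lists *)

Section Actions.
Variables (R : realType) (G : wgraph R) (s : G).
Implicit Types (x y : seq (action G)) (v : G).

Lemma route_cat x y : route (x ++ y) = route x ++ route y.
Proof. exact: pmap_cat. Qed.

Lemma route_map_move p : route (map (@Move R G) p) = p.
Proof. by elim: p => //= v p; rewrite /route /= => ->. Qed.

Lemma all_wait_move p :
  all (fun a => 0 <= wait_time a) (map (@Move R G) p).
Proof. by elim: p => //= v p ->; rewrite lexx. Qed.

Lemma duration_cat x y : duration s (x ++ y) =
  duration s x + duration (last s (route x)) y.
Proof.
by rewrite /duration /travelled route_cat walk_len_cat big_cat /= addrACA.
Qed.

Lemma duration_map_move p : duration s (map (@Move R G) p) = walk_len s p.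
Proof.
by rewrite /duration /travelled route_map_move big_map big1 // addr0.
Qed.

Lemma travelled_le_duration x : all (fun a => 0 <= wait_time a) x ->
  travelled s x <= duration s x.
Proof.
rewrite /duration lerDl; elim: x => [|a x IH] /=; first by rewrite big_nil.
by move=> /andP[a0 /IH]; rewrite big_cons; apply: addr_ge0.
Qed.

End Actions.

(** * The invariant of the AMP loop *)

Section Run.
Variables (R : realType) (G : wgraph R) (s : G).
Hypothesis cycG : is_cycle G.
Implicit Types st : amp_state G.

(** [inv_dist] and [inv_nearest] together make [dist] the graph distance from [s]. [inv_duration]
    holds because one agent waits exactly while the other moves, so both clocks show the sum of the
    two distances. [inv_cut] confines the frontier to the two next edges. *)
Record amp_inv (st : amp_state G) : Prop := AmpInv {
  inv_path : forall i, path (@adj R G) s (route (done_actions st i));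
  inv_last : forall i, last s (route (done_actions st i)) = pos st i;
  inv_dist : forall i, travelled s (done_actions st i) = dist st i;
  inv_wait : forall i, all (fun a => 0 <= wait_time a) (done_actions st i);
  inv_duration : forall i,
    duration s (done_actions st i) = dist st a1 + dist st a2;
  inv_nxt : forall i, adj (pos st i) (nxt st i);
  inv_visited : forall v, v \in visited st ->
    exists i, v \in s :: route (done_actions st i);
  inv_start : s \in visited st;
  inv_pos : forall i, pos st i \in visited st;
  inv_cut : forall u w, u \in visited st -> w \notin visited st -> adj u w ->
    exists i, u = pos st i /\ w = nxt st i;
  inv_nearest : forall i q, path (@adj R G) s q -> last s q = pos st i ->
    dist st i <= walk_len s q
}.

Lemma amp_init_inv n1 : adj s n1 -> amp_inv (amp_init s n1).
Proof.
move=> sn; have [so nbr] := other_nbrP cycG sn.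
split=> //=.
- by move=> i; rewrite /duration /travelled big_nil.
- by move=> i; case: ifP.
- by move=> v; rewrite inE => /eqP->; exists a1; rewrite inE.
- by rewrite inE.
- by move=> _; rewrite inE.
- move=> u w; rewrite inE => /eqP-> _ /nbr[]->; first by exists a1.
  by exists a2.
- by move=> _ q pq _; apply: walk_len_ge0.
Qed.

Lemma amp_mover_min st i :
  dist st (amp_mover st) + len (pos st (amp_mover st)) (nxt st (amp_mover st))
  <= dist st i + len (pos st i) (nxt st i).
Proof. by rewrite /amp_mover; case: ltP; case: (ord2_case i) => -> // /ltW. Qed.

(* If the mover's next node were visited, the next edge of the other agent would
   be the only edge leaving the visited set, whereas a cut of a cycle is even. *)
Lemma amp_mover_fresh st : amp_inv st -> visited st != [set: G]%SET ->
  nxt st (amp_mover st) \notin visited st.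
Proof.
move=> I; rewrite -finset.subTset => /subsetPn[v _ vS]; apply/negP => mS.
have [x [y [xS yS xy]]] := cut_edge (inv_start I) vS.
have [u [w [uS wS uw]]] := cycle_bridgeless cycG xS yS xy; case.
have [i [-> ei]] := inv_cut I xS yS xy; have [j [-> ej]] := inv_cut I uS wS uw.
suff ji : j = i; first by rewrite ei ej ji.
have ij k : nxt st k \notin visited st -> k != amp_mover st.
  by apply: contraNneq => ->.
move: (ij i) (ij j); rewrite -ei -ej => /(_ yS) + /(_ wS).
by case: (ord2_case i) (ord2_case j) (ord2_case (amp_mover st))
  => -> [] -> [] ->.
Qed.

Lemma amp_move_inv st : amp_inv st -> nxt st (amp_mover st) \notin visited st ->
  amp_inv (amp_move st).
Proof.
move=> I; rewrite /amp_move.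
have minm := amp_mover_min st.
set m := amp_mover st in minm *; set u := pos st m; set v := nxt st m => vS.
have uv : adj u v := inv_nxt I m.
have [vo nbr] := other_nbrP cycG (etrans (adj_sym v u) uv).
have route_move i : route (rcons (done_actions st i)
    (if i == m then Move v else Wait (len u v))) =
    route (done_actions st i) ++ (if i == m then [:: v] else [::]).
  by rewrite -cats1 route_cat; case: (i == m).
have last_route i : last s (route (done_actions st i)) = pos st i := inv_last I i.
have trav i : travelled s (rcons (done_actions st i)
    (if i == m then Move v else Wait (len u v))) =
    if i == m then dist st i + len u v else dist st i.
  rewrite /travelled route_move walk_len_cat -(inv_dist I) last_route.
  by case: eqP => [->|_] /=; rewrite ?addr0.
split=> //=.
- move=> i; rewrite route_move cat_path (inv_path I) (inv_last I).
  by case: eqP => [->|_] //=; rewrite andbT.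
- by move=> i; rewrite route_move last_cat last_route; case: eqP.
- move=> i; rewrite all_rcons (inv_wait I) andbT.
  by case: (i == m); rewrite /= ?lexx // ltW ?len_gt0.
- move=> i; rewrite /duration trav -cats1 big_cat big_seq1 /=.
  have := inv_duration I i; rewrite /duration (inv_dist I).
  move: (\sum_(_ <- _) _) (len u v) => W l.
  by case: (ord2_case m) (ord2_case i) => -> [->|->] /= e; lra.
- by move=> i; case: eqP => // _; apply: (inv_nxt I).
- move=> w; rewrite in_setU1 => /orP[/eqP->|/(inv_visited I)[i wi]].
    by exists m; rewrite route_move eqxx inE mem_cat inE eqxx !orbT.
  by exists i; rewrite route_move -cat_cons mem_cat wi.
- by rewrite in_setU1 (inv_start I) orbT.
- by move=> i; rewrite in_setU1; case: (i == m); rewrite ?eqxx // (inv_pos I) orbT.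
(* An edge leaving the enlarged set from [v] cannot lead back to the visited [u], so it is the new
   next edge of [m]. Any other leaving edge was already a next edge, and not that of [m], since it
   does not end in [v]. *)
- move=> x y; rewrite !in_setU1 negb_or => /orP[/eqP->|xS] /andP[yv yS] xy.
    have [yu|->] := nbr _ xy; last by exists m; rewrite eqxx.
    by rewrite yu (inv_pos I) in yS.
  have [i [-> yi]] := inv_cut I xS yS xy; exists i.
  by case: eqP => // im; rewrite yi im eqxx in yv.
(* A walk to the new node [v] leaves the old visited set along the next edge of some agent [j]. Up
   to the end of that edge it is at least as long as the candidate distance of [j], which the
   mover's does not exceed. *)
- move=> i q pq lq; case: eqP lq => [->|_] lq; last exact: (inv_nearest I).
  rewrite -lq in vS.
  have [q1 [w [q2 [eq lS wS lw]]]] := walk_exit pq (inv_start I) vS.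
  have [j [ej wj]] := inv_cut I lS wS lw.
  move: pq; rewrite eq cat_path /= => /and3P[p1 _ p2].
  rewrite walk_len_cat /= ej wj addrA.
  apply: le_trans (minm j) _; rewrite ler_wpDr ?walk_len_ge0 -?wj //.
  by rewrite lerD2r; apply: (inv_nearest I).
Qed.

Lemma amp_loop_inv n1 : adj s n1 ->
  amp_inv (amp_loop s n1) /\ visited (amp_loop s n1) = [set: G]%SET.
Proof.
move=> sn; rewrite /amp_loop.
(* The strict inequality starts from the single visited node [s] and grows with every effective
   pass; at [k = #|G|] it is impossible. *)
have iter_inv k (st := iter k (@amp_pass R G) (amp_init s n1)) :
    amp_inv st /\ (visited st = [set: G]%SET \/ (k < #|visited st|)%N).
  elim: k @st => [|k [I vk]] /=.
    by split; [apply: amp_init_inv | right; rewrite cards1].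
  rewrite /amp_pass; case: eqP => [?|/eqP nv]; first by split; [|left].
  have fresh := amp_mover_fresh I nv; split; first exact: amp_move_inv.
  right; rewrite /= cardsU1 fresh add1n ltnS.
  by case: vk => // e; rewrite e eqxx in nv.
have [I [//|]] := iter_inv #|G|.
by rewrite ltnNge max_card.
Qed.

Definition radius st := Num.max (dist st a1) (dist st a2).

(** * Return walks and lower bounds after the loop *)

Section Final.
Variable st : amp_state G.
Hypothesis I : amp_inv st.
Hypothesis all_visited : visited st = [set: G]%SET.

Lemma dist_ge0 i : 0 <= dist st i.
Proof. by rewrite -(inv_dist I) walk_len_ge0 ?(inv_path I). Qed.

Lemma dist_le_radius i : dist st i <= radius st.
Proof.
by case: (ord2_case i) => ->; rewrite /radius le_max lexx ?orbT.
Qed.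

(** The reversed outward walk has length [dist st i], and by [inv_nearest] no return walk is
    shorter. So a shortest walk exists and [xget] does not fall back on its default. *)
Lemma return_walkP i
    (r := xget [::] [set p | shortest_walk (pos st i) s p]%classic) :
  [/\ path (@adj R G) (pos st i) r, last (pos st i) r = s &
    walk_len (pos st i) r = dist st i].
Proof.
have far q : path (@adj R G) (pos st i) q -> last (pos st i) q = s ->
    dist st i <= walk_len (pos st i) q.
  by move=> /walk_rev[q' [+ + <-]] e; rewrite e; apply: (inv_nearest I).
have [q []] := walk_rev (inv_path I i).
rewrite (inv_last I) -/(travelled _ _) (inv_dist I) => pq lq wq.
have : shortest_walk (pos st i) s r.
  apply: (@xgetI _ [::] [set p | shortest_walk (pos st i) s p]%classic q).
  by split=> // q'; rewrite wq; apply: far.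
case=> pr lr minr; split=> //; apply/le_anti.
by rewrite -{1}wq minr // far.
Qed.

(** The route of an agent through [pos st i] splits there into a walk out and a walk back, each of
    length at least [dist st i]. Bounding the energy suffices for the time model too, through
    [energy_le_time]. *)
Lemma exploration_ge (X : strategy G 2) : is_exploration s X ->
  2 * radius st <= energy_cost s X.
Proof.
case=> _ pX lX vX.
have ge_dist i : 2 * dist st i <= energy_cost s X.
  have [j /splitPl sp] := vX (pos st i); rewrite /energy_cost.
  apply: (bigmax_sup j) => //; rewrite /travelled.
  move: (pX j) (lX j); case: sp => p1 p2 lp1; rewrite cat_path last_cat walk_len_cat lp1.
  case/andP=> pp1 /walk_rev[q [+ + <-]] l2; rewrite l2 => pq lq.
  by rewrite mulr_natl mulr2n lerD ?(inv_nearest I).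
by rewrite /radius; case: (leP (dist st a1)) => _; apply: ge_dist.
Qed.

(** Makes both optima positive, so that the cost ratios are genuine quotients. *)
Lemma radius_gt0 n1 : adj s n1 -> 0 < radius st.
Proof.
move=> sn; have /(inv_visited I)[i] : n1 \in visited st.
  by rewrite all_visited finset.in_setT.
rewrite inE => /orP[/eqP e|ni]; first by rewrite e adj_irr in sn.
apply: lt_le_trans (dist_le_radius i).
by rewrite -(inv_dist I) (walk_len_gt0 _ ni) ?(inv_path I).
Qed.

(** With unit lengths, each distance counts the nodes entered, and these nodes together with [s]
    cover the graph. *)
Lemma unit_dist_sum : (forall v w : G, len v w = 1) ->
  #|G|%:R <= 1 + dist st a1 + dist st a2.
Proof.
move=> len1; rewrite -!(inv_dist I) /travelled !walk_len_unit //.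
rewrite nat1r -natrD ler_nat addSn -size_cat -[X in (_ <= X)%N]/(size (s :: _)).
apply: leq_trans (card_size _); apply/subset_leq_card/fintype.subsetP => v _.
have /(inv_visited I)[i] : v \in visited st by rewrite all_visited finset.in_setT.
by case: (ord2_case i) => ->; rewrite !inE mem_cat => /orP[->|->]; rewrite ?orbT.
Qed.

End Final.

(** * Correctness and costs of AMP *)

Section Amp.
Variable first : forall G : wgraph R, G -> G.
Hypothesis adj_first : adj s (first s).
Let st := amp_loop s (first s).
Let I : amp_inv st := (amp_loop_inv adj_first).1.
Let all_visited : visited st = [set: G]%SET := (amp_loop_inv adj_first).2.

Lemma amp_exploration : is_exploration s (amp first s).
Proof.
split=> [i|i|i|v]; rewrite /amp -/st.
- by rewrite all_cat (inv_wait I) all_wait_move.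
- rewrite route_cat route_map_move cat_path (inv_path I) (inv_last I).
  by case: (return_walkP I i).
- rewrite route_cat route_map_move last_cat (inv_last I).
  by case: (return_walkP I i).
- have /(inv_visited I)[i vi] : v \in visited st by rewrite all_visited finset.in_setT.
  by exists i; rewrite route_cat -cat_cons mem_cat vi.
Qed.

Lemma amp_energy : energy_cost s (amp first s) = 2 * radius st.
Proof.
have e i : travelled s (amp first s i) = dist st i + dist st i.
  rewrite /travelled route_cat route_map_move walk_len_cat (inv_last I).
  by case: (return_walkP I i) => _ _ ->; rewrite -(inv_dist I).
rewrite /energy_cost bigmax_ord2 => [|i]; rewrite ?e; last first.
  by rewrite addr_ge0 // dist_ge0.
by rewrite /radius; case: (leP (dist st a1)) => ?; case: leP => ?; lra.
Qed.

Lemma amp_time :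
  time_cost s (amp first s) = dist st a1 + dist st a2 + radius st.
Proof.
have e i : duration s (amp first s i) = dist st a1 + dist st a2 + dist st i.
  rewrite duration_cat duration_map_move (inv_last I) (inv_duration I).
  by case: (return_walkP I i) => _ _ ->.
rewrite /time_cost bigmax_ord2 => [|i]; rewrite ?e; last first.
  by rewrite !addr_ge0 // dist_ge0.
by rewrite /radius; case: (leP (dist st a1)) => ?; case: leP => ?; lra.
Qed.

End Amp.
End Run.

(** * Bounds on the optimum as an infimum *)

Section Optimum.
Variables (R : realType) (G : wgraph R) (s : G).

Lemma energy_le_time k (X : strategy G k) : is_exploration s X ->
  energy_cost s X <= time_cost s X.
Proof.
by case=> wX _ _ _; apply: le_bigmax2 => i _; apply: travelled_le_duration.
Qed.

(** The exploration [X] makes the set of costs nonempty, so that a lower bound passes to its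
    infimum. *)
Lemma le_opt (cost : cost_model R) k (X : strategy G k) c :
  is_exploration s X ->
  (forall Y : strategy G k, is_exploration s Y -> c <= cost G s k Y) ->
  c <= opt cost s k.
Proof.
move=> eX le_c; apply: lb_le_inf; first by exists (cost G s k X), X.
by move=> _ [Y eY <-]; apply: le_c.
Qed.

Lemma opt_le (cost : cost_model R) k (X : strategy G k) :
  is_exploration s X -> (forall Y : strategy G k, 0 <= cost G s k Y) ->
  opt cost s k <= cost G s k X.
Proof.
move=> eX ge0; apply: ge_inf; last by exists X.
by exists 0 => _ [Y _ <-]; apply: ge0.
Qed.

End Optimum.

(** * The triangle with unit lengths *)

Section Triangle.
Variable R : realType.

Lemma triangle_conn (u v : 'I_3) : connect (fun x y : 'I_3 => x != y) u v.
Proof. by have [->|uv] := eqVneq u v; [apply: connect0 | apply: connect1]. Qed.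

Definition triangle : wgraph R :=
  @WGraph R 'I_3 (fun x y => x != y) (fun _ _ => 1)
  (fun x y => congr1 negb (eq_sym x y)) (fun x => negbF (eqxx x)) triangle_conn
  (fun _ _ => erefl) (fun _ _ _ => ltr01).

Lemma triangle_cycle : is_cycle triangle.
Proof.
move=> u; transitivity #|[set~ u]%SET|; last by rewrite cardsC1 card_ord.
by apply: eq_card => v; rewrite !inE eq_sym.
Qed.

(** Each agent visits one of the two other nodes and returns at once, at time 2. *)
Lemma triangle_opt_time (s : triangle) : opt (@time_cost R) s 2 <= 2.
Proof.
have [u [v [su sv suv]]] : exists u v : triangle,
    [/\ s != u, s != v & forall w, w \in [:: s; u; v]].
  have /eqP/cards2P[u [v [_ e]]] := triangle_cycle s.
  have mem w : (s != w) = (w \in [set u; v]%SET).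
    by rewrite -e inE.
  exists u, v; rewrite !mem !inE !eqxx orbT; split=> // w.
  have := mem w; rewrite !inE [w == s]eq_sym.
  by case: eqP => //= _ <-.
pose X : strategy triangle 2 :=
  fun i => map Move [:: (if i == a1 then u else v); s].
have eX : is_exploration s X.
  split=> [i|i|i|w].
  - exact: all_wait_move.
  - by rewrite route_map_move; case: ifP => _ /=; rewrite ?su ?sv eq_sym ?su ?sv.
  - by rewrite route_map_move; case: ifP.
  - have := suv w; rewrite !inE => /or3P[] w_.
    + by exists a1; rewrite inE w_.
    + by exists a1; rewrite route_map_move !inE /= w_ orbT.
    + by exists a2; rewrite route_map_move !inE /= w_ orbT.
apply: le_trans (opt_le eX _) _ => [Y|]; first exact: bigmax_ge_id.
apply: bigmax_le => [|i _]; first by [].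
by rewrite duration_map_move /= addr0.
Qed.

End Triangle.

Theorem theorem4 (R : realType) (first : forall G : wgraph R, G -> G)
    (Hfirst : forall (G : wgraph R) (s : G), is_cycle G -> adj s (first G s)) :
  has_competitive_ratio (@energy_cost R) (@is_cycle R) (amp first) 1 /\
  has_competitive_ratio (@time_cost R) (@is_cycle R) (amp first) (3 / 2).
Proof.
have explo (G : wgraph R) (s : G) : is_cycle G -> is_exploration s (amp first s).
  by move=> cG; apply: amp_exploration => //; apply: Hfirst.
have energy1 (G : wgraph R) (s : G) : is_cycle G ->
    energy_cost s (amp first s) / opt (@energy_cost R) s 2 = 1.
  move=> cG; have sn := Hfirst G s cG; have [I V] := amp_loop_inv cG sn.
  (* The energy of AMP equals the lower bound of [exploration_ge], so AMP is optimal. *)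
  have -> : opt (@energy_cost R) s 2 = energy_cost s (amp first s).
    apply/le_anti; rewrite opt_le ?andTb; last 2 first.
    - exact: explo.
    - by move=> Y; apply: bigmax_ge_id.
    apply: (le_opt (explo _ s cG)) => Y eY.
    by rewrite amp_energy //; apply: exploration_ge.
  rewrite divff // amp_energy // gt_eqF // mulr_gt0 //.
  exact: (radius_gt0 I V sn).
have opt_time (G : wgraph R) (s : G) : is_cycle G ->
    2 * radius (amp_loop s (first G s)) <= opt (@time_cost R) s 2.
  move=> cG; have sn := Hfirst G s cG; have [I V] := amp_loop_inv cG sn.
  apply: (le_opt (explo _ s cG)) => Y eY.
  by apply: le_trans (energy_le_time eY); apply: exploration_ge.
(* The triangle is the worst case for time, and it also shows that the class of cycles is nonempty,
   as the energy supremum requires. *)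
pose T := triangle R; pose t : T := ord0; have cT : is_cycle T := @triangle_cycle R.
split; (split; first by move=> G s; apply: explo); apply/le_anti/andP; split.
- by apply: ge_ereal_sup => _ [G [s [cG ->]]]; rewrite energy1.
- by apply: ereal_sup_ubound; exists T, t; rewrite energy1.
- apply: ge_ereal_sup => _ [G [s [cG ->]]]; rewrite lee_fin.
  have sn := Hfirst G s cG; have [I V] := amp_loop_inv cG sn.
  have r0 := radius_gt0 I V sn; have rO := opt_time G s cG.
  (* Both distances are at most the radius, so the time is at most three radii, and the optimum is
     at least two. *)
  rewrite ler_pdivrMr ?amp_time //; last by lra.
  have := dist_le_radius (amp_loop s (first G s)) a1.
  have := dist_le_radius (amp_loop s (first G s)) a2.
  lra.
- have sn := Hfirst T t cT; have [I V] := amp_loop_inv cT sn.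
  have r0 := radius_gt0 I V sn; have rO := opt_time T t cT.
  (* On the triangle the distances sum to at least 2, so the radius is at least 1 and AMP needs time
     at least 3, against an optimum of at most 2. *)
  apply: (@le_trans _ _ (time_cost t (amp first t) / opt (@time_cost R) t 2)%:E).
    rewrite lee_fin ler_pdivlMr ?amp_time //; last by lra.
    have := dist_le_radius (amp_loop t (first T t)) a1.
    have := dist_le_radius (amp_loop t (first T t)) a2.
    have := triangle_opt_time t.
    have := unit_dist_sum I V (fun _ _ => erefl).
    rewrite card_ord; lra.
  by apply: ereal_sup_ubound; exists T, t.
Qed.
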